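(* Let $(X,\mathrm{dist})$ be a metric space, let $\mathcal{H}\subseteq\{0,1\}^X$ be a hypothesis class of finite VC-dimension $\mathrm{VC}(\mathcal{H})<\infty$, and let $\mathcal{V}$ and $\mathcal{U}$ be perturbation types that are balls of radii $r(1+\gamma)$ and $r$ respectively, i.e. $\mathcal{V}(x)=\mathcal{B}_{(1+\gamma)r}(x)$ and $\mathcal{U}(x)=\mathcal{B}_r(x)$ for all $x\in X$, for some $r>0$ and $\gamma>0$. Let the discretization $C\subseteq X$ (a countable set) be an $r\gamma$-cover of $X$, let $\mathcal{C}$ be the induced perturbation type, $\mathcal{C}(x)=\mathcal{V}(x)\cap C$ for all $x\in X$, and let $k$ be a uniform upper bound on the sizes of the perturbation sets in $\mathcal{C}$, that is, $|\mathcal{C}(x)|\le k$ for all $x\in X$. Then the algorithm RERM-and-Discretize (described in the context) $\gamma$-tolerantly robustly PAC learns $\mathcal{H}$. Moreover, the sample complexity in the tolerantly realizable case is bounded by $$m(\epsilon,\delta)=\tilde{O}\left(\frac{\mathrm{VC}(\mathcal{H})\log(k)+\log(1/\delta)}{\epsilon}\right)$$ and in the agnostic case by $$n(\epsilon,\delta)=\tilde{O}\left(\frac{\mathrm{VC}(\mathcal{H})\log(k)+\log(1/\delta)}{\epsilon^2}\right).$$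
   Context: Setting. $Y=\{0,1\}$; a hypothesis is a function $h:X\to Y$ and a hypothesis class $\mathcal{H}$ is a set of hypotheses. Loss sets are assumed measurable. A perturbation type is a map $\mathcal{U}:X\to 2^X$. $\mathcal{B}_\rho(x)=\{z\in X:\mathrm{dist}(x,z)\le\rho\}$. A set $C\subseteq X$ is an $r\gamma$-cover of $X$ if for all $x\in X$ there is $c\in C$ with $\mathrm{dist}(x,c)\le r\gamma$. $\tilde O$ is the usual soft-$O$ notation. Adversarial loss. For $(x,y)\in X\times Y$, $\ell^{\mathcal{U}}(h,x,y)=\max_{z\in\mathcal{U}(x)}\mathbf{1}[h(z)\ne y]$. For a distribution $P$ on $X\times Y$, $\mathcal{L}^{\mathcal{U}}_P(h)=\mathbb{E}_{(x,y)\sim P}\,\ell^{\mathcal{U}}(h,x,y)$ and $\mathcal{L}^{\mathcal{U}}_P(\mathcal{H})=\inf_{h\in\mathcal{H}}\mathcal{L}^{\mathcal{U}}_P(h)$; for a finite sample $S=((x_1,y_1),\dots,(x_n,y_n))$, $\mathcal{L}^{\mathcal{U}}_S(h)=\frac1n\sum_{i=1}^n\ell^{\mathcal{U}}(h,x_i,y_i)$. The same notation is used for the perturbation types $\mathcal{V}$ and $\mathcal{C}$. Tolerant learning. A learner $\mathcal{A}$ (a map from finite labeled samples to hypotheses) $\gamma$-tolerantly robustly PAC learns $\mathcal{H}$ with respect to a set $\mathcal{P}$ of distributions over $X\times Y$ with $m:(0,1)^2\to\mathbb{N}$ samples if for every $P\in\mathcal{P}$ and $\epsilon,\delta\in(0,1)$,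 when $S$ is an i.i.d. sample from $P$ of size at least $m(\epsilon,\delta)$, with probability at least $1-\delta$ we have $\mathcal{L}^{\mathcal{U}}_P(\mathcal{A}(S))\le\mathcal{L}^{\mathcal{V}}_P(\mathcal{H})+\epsilon$. In the agnostic case $\mathcal{P}$ is the set of all distributions over $X\times Y$; in the tolerantly realizable case $\mathcal{P}=\{P:\mathcal{L}^{\mathcal{V}}_P(\mathcal{H})=0\}$. RERM oracle. An RERM oracle $\mathcal{A}^{\mathcal{C}}_{\mathcal{H}}$ maps a labeled sample $S$ to an arbitrary element of $\arg\min_{h\in\mathcal{H}}\mathcal{L}^{\mathcal{C}}_S(h)$. Algorithm RERM-and-Discretize. Given labeled data $S$, the discretization $C$ and an RERM oracle $\mathcal{A}^{\mathcal{C}}_{\mathcal{H}}$: set $\hat h=\mathcal{A}^{\mathcal{C}}_{\mathcal{H}}(S)$ and output $\mathrm{nn}_C(\hat h)$ defined by $\mathrm{nn}_C(\hat h)(x)=\hat h(z)$ for some $z\in\arg\min_{c\in C}\mathrm{dist}(x,c)$ (ties broken arbitrarily).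
   Formalization: In both sample complexity bounds log(k) is read as log(max(2,k)); for k = 1 the literal bound would not depend on VC(H), which is false already for ordinary PAC learning on a discrete space where all perturbation sets are singletons. *)

(* Defs.v *)
From HB Require Import structures.
From mathcomp Require Import all_boot all_order all_algebra.
From mathcomp Require Import all_classical all_reals all_analysis.

Set Implicit Arguments.
Unset Strict Implicit.
Unset Printing Implicit Defensive.

Import Order.TTheory GRing.Theory Num.Theory.
Local Open Scope classical_set_scope.
Local Open Scope card_scope.
Local Open Scope ring_scope.

(* No compatibility between the metric and the sigma-algebra is imposed, so
   this covers in particular a metric space with its Borel sigma-algebra. *)
#[short(type="metricMeasurableType")]
HB.structure Definition MetricMeasurable (d : measure_display)
  (R : numDomainType) := { T of Metric R T & Measurable d T }.

Section iid_sample.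
Context (d : measure_display) (T : measurableType d) (R : realType).

Definition tuple_cons (n : nat) (z : T * n.-tuple T) : n.+1.-tuple T :=
  [tuple of z.1 :: z.2].

Lemma measurable_tuple_cons (n : nat) :
  measurable_fun [set: T * n.-tuple T] (@tuple_cons n).
Proof. exact: measurable_cons. Qed.

HB.instance Definition _ (n : nat) :=
  @isMeasurableFun.Build _ _ _ _ (@tuple_cons n) (@measurable_tuple_cons n).

Fixpoint iid (P : probability T R) (n : nat) : probability (n.-tuple T) R :=
  match n with
  | 0%N => \d_([tuple] : 0.-tuple T)
  | n'.+1 => distribution (P \x iid P n')%E (@tuple_cons n')
  end.

End iid_sample.

Section vc_dimension.
Context (X : Type).

Definition shatters (H : set (X -> bool)) (A : set X) : Prop :=
  forall B, B `<=` A -> exists2 h, H h & A `&` [set x | h x] = B.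

Definition is_VCdim (H : set (X -> bool)) (d : nat) : Prop :=
  (exists2 A : set X, A #= `I_d & shatters H A) /\
  (forall (n : nat) (A : set X), A #= `I_n -> shatters H A -> (n <= d)%N).

End vc_dimension.

Section tolerant_learning.
Context (d : measure_display) (R : realType) (X : metricMeasurableType d R).

Implicit Types (U V : X -> set X) (h : X -> bool) (H : set (X -> bool)).
Implicit Types (P : probability (X * bool)%type R) (S : seq (X * bool)).
Implicit Types (C : set X) (A : seq (X * bool) -> X -> bool).

(* the library's closed_ball is the closure of the open ball, which can be
   strictly smaller *)
Definition ball_perturbation (rho : R) (x : X) : set X :=
  [set z | mdist x z <= rho].

Definition is_cover C (rho : R) : Prop :=
  forall x, exists2 c, C c & mdist x c <= rho.

(* The supremum is over a subset of {0, 1}, hence a maximum as soon as U x is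
   nonempty. *)
Definition adv_loss U h (x : X) (y : bool) : R :=
  sup [set (h z != y)%:R | z in U x].

Definition loss_set U h : set (X * bool) :=
  [set z | adv_loss U h z.1 z.2 = 1].

Definition adv_risk U P h : \bar R :=
  (\int[P]_z (adv_loss U h z.1 z.2)%:E)%E.

Definition opt_risk U P H : \bar R := ereal_inf [set adv_risk U P h | h in H].

(* For the empty sample this is 0, so that every hypothesis is then a
   minimizer. *)
Definition emp_risk U S h : R :=
  (\sum_(z <- S) adv_loss U h z.1 z.2) / (size S)%:R.

Definition is_RERM U H (oracle : seq (X * bool) -> X -> bool) : Prop :=
  forall S, H (oracle S) /\
    forall h, H h -> emp_risk U S (oracle S) <= emp_risk U S h.

Definition nearest C (x : X) : set X :=
  [set c | C c /\ forall c', C c' -> mdist x c <= mdist x c'].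

(* g is one of the possible values of nn_C(h), one for each way of breaking
   ties *)
Definition is_nn C h (g : X -> bool) : Prop :=
  forall x, exists2 z, nearest C x z & g x = h z.

Definition RERM_and_Discretize C (oracle : seq (X * bool) -> X -> bool) A :
  Prop := forall S, is_nn C (oracle S) (A S).

(* "With probability at least 1 - delta" is stated through a measurable event
   contained in the success event: a learner built from an arbitrary oracle
   need not depend measurably on the sample.  If the success event is
   measurable, this says exactly that its probability is at least 1 - delta. *)
Definition tolerantly_PAC_learns U V H (Ps : set (probability (X * bool)%type R))
    A (m : R -> R -> nat) : Prop :=
  forall P, Ps P -> forall eps delta : R,
  0 < eps < 1 -> 0 < delta < 1 -> forall n : nat, (m eps delta <= n)%N ->
  exists E : set (n.-tuple (X * bool)),
    [/\ measurable E, ((1 - delta)%:E <= iid P n E)%E &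
        forall S : n.-tuple (X * bool), E S ->
          (adv_risk U P (A S) <= opt_risk V P H + eps%:E)%E].

Definition agnostic : set (probability (X * bool)%type R) := setT.

Definition tolerantly_realizable V H : set (probability (X * bool)%type R) :=
  [set P | opt_risk V P H = 0%E].

End tolerant_learning.

(* f = O(g log^c g) for some c, uniformly on D; the shift by 2 keeps the
   logarithm bounded away from 0 when g >= 0 is small. *)
Definition softO (R : realType) (I : Type) (D : set I) (f g : I -> R) : Prop :=
  exists (K : R) (c : nat), forall i, D i -> f i <= K * g i * ln (2 + g i) ^+ c.

(* Parameters (VC-dimension, k, eps, delta). *)
Definition parameters (R : realType) : set (nat * nat * R * R) :=
  [set p | let: (vc, k, eps, delta) := p in 0 < eps < 1 /\ 0 < delta < 1].

(* VC(H) log k + log (1 / delta), where log k is read as log (max(2, k)): for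
   k = 1 the perturbation sets can all be singletons, and then, as in ordinary
   PAC learning, the dependence on the VC-dimension cannot vanish. *)
Definition complexity (R : realType) (vc k : nat) (delta : R) : R :=
  vc%:R * ln (maxn 2 k)%:R + ln (1 / delta).

Definition realizable_rate (R : realType) (p : nat * nat * R * R) : R :=
  let: (vc, k, eps, delta) := p in complexity vc k delta / eps.

Definition agnostic_rate (R : realType) (p : nat * nat * R * R) : R :=
  let: (vc, k, eps, delta) := p in complexity vc k delta / eps ^+ 2.

Definition sample_size (R : realType) (m : nat -> nat -> R -> R -> nat)
    (p : nat * nat * R * R) : R :=
  let: (vc, k, eps, delta) := p in (m vc k eps delta)%:R.

(* Main.v *)
(* The perturbation sets C(x) are finite subsets of a countable set, so that the
   losses l^C(h, _, _) cannot separate more than countably many classes of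
   points: they all factor through one measurable map to nat, and every event
   about samples becomes measurable. On n points these losses involve at most nk
   points of C, hence by Sauer's lemma they have at most (2nk + 1)^VC(H) traces.
   For a loss f of mean p and weights a, b, the quantity
   b^(#errors on S) (1 + (a - 1) p)^n is the average over a ghost sample S' of
   b^(#errors on S) a^(#errors on S'); swapping the entries of S and S' at random
   bounds the average of its supremum over f by the number of traces times
   max((a + b) / 2, a b, 1)^n. Markov's inequality yields the realizable rate for
   (a, b) = (2, 0), and the agnostic one for (a, b) = (e^t, e^-t).
   Since C is an r gamma-cover, the nearest point in C of a point of B_r(x) lies
   in C(x), so that l^U(nn_C(h), _, _) <= l^C(h, _, _) <= l^V(h, _, _). *)
From HB Require Import structures.
Require Import Defs.
From mathcomp Require Import all_boot all_order all_algebra.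
From mathcomp Require Import all_classical all_reals all_analysis.
From mathcomp Require Import measurable_realfun finmap zify lra ring.

Set Implicit Arguments.
Unset Strict Implicit.
Unset Printing Implicit Defensive.

Import Order.TTheory GRing.Theory Num.Theory.
Local Open Scope classical_set_scope.
Local Open Scope card_scope.
Local Open Scope ring_scope.

Lemma leq_expl (e a b : nat) : (a <= b)%N -> (a ^ e <= b ^ e)%N.
Proof. by case: e => // e ab; rewrite leq_exp2r. Qed.

(** * Traces of a class of finite VC dimension *)

Section representatives.
Context (X : choiceType).
Implicit Types (H : set (X -> bool)) (D A : seq X) (L : seq (X -> bool)).

(** Members of [L] must lie in [H]: the induction in [sauer] reuses them as witnesses, of shattering
    and of flips. *)
Definition traces_covered H D L : Prop :=
  (forall l, List.In l L -> H l) /\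
  forall h, H h -> exists2 l, List.In l L & {in D, h =1 l}.

Definition seq_shatters H A : Prop :=
  forall b : X -> bool, exists2 h, H h & {in A, h =1 b}.

Lemma seq_choice (T U : Type) (P : T -> U -> Prop) (s : seq T) :
  (forall t, List.In t s -> exists u, P t u) ->
  exists2 s' : seq U, size s' = size s &
    (forall t, List.In t s -> exists2 u, List.In u s' & P t u) /\
    (forall u, List.In u s' -> exists2 t, List.In t s & P t u).
Proof.
elim: s => [|t s IHs] sP; first by exists [::].
have [u Ptu] := sP t (or_introl erefl).
have [|s' ss' [Ps Ps']] := IHs; first by move=> v vs; apply: sP; right.
exists (u :: s'); first by rewrite /= ss'.
split=> v /= [<-|vs].
- by exists u => //; left.
- by have [w ws' Pvw] := Ps v vs; exists w => //; right.
- by exists t => //; left.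
- by have [w ws' Pvw] := Ps' v vs; exists w => //; right.
Qed.

(* The hypotheses that can be flipped at a new point without being changed on
   D form a class of smaller dimension. The crude count
   N(n + 1, d + 1) <= N(n, d + 1) + 2 N(n, d) yields the bound. *)
Lemma sauer H D d : uniq D ->
  (forall A, uniq A -> {subset A <= D} -> seq_shatters H A -> (size A <= d)%N) ->
  exists2 L, (size L <= ((size D).*2.+1) ^ d)%N & traces_covered H D L.
Proof.
elim: D H d => [|x D IHD] H d.
  move=> _ _; have [[h Hh]|nH] := pselect (exists h, H h).
    exists [:: h]; first by rewrite expn_gt0.
    by split=> [l [<-|//]//|g Hg]; exists h => //; left.
  by exists [::] => //; split=> // h Hh; case: nH; exists h.
move=> /= /andP[xD uD] HD.
pose H2 := [set h | H h /\ exists2 h', H h' & {in D, h =1 h'} /\ h' x = ~~ h x].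
have [|L1 sL1 [L1H HL1]] := IHD H d uD.
  by move=> A uA AD; apply: HD => // z /AD; rewrite inE => ->; rewrite orbT.
(* In dimension 0 no single point is shattered, so all hypotheses agree at [x] and [L1] still
   suffices. *)
case: d HD sL1 => [|d] HD sL1.
  exists L1 => //; split=> // h Hh; have [l lL1 hl] := HL1 h Hh.
  exists l => // z; rewrite inE => /orP[/eqP->|]; last exact: hl.
  apply/eqP; apply: contraT => hxl; suff : (size [:: x] <= 0)%N by [].
  apply: HD => // [z'|b]; first by rewrite inE => /eqP ->; rewrite mem_head.
  have [bx|bx] := eqVneq (b x) (h x).
    by exists h => // z'; rewrite inE => /eqP ->.
  exists l; first exact: L1H.
  move=> z'; rewrite inE => /eqP ->.
  by case: (b x) (h x) (l x) bx hxl => [] [] [].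
(* If [H2] shatters [A], then [H] shatters [x :: A], by flipping at [x] where needed; hence the
   dimension drops. *)
have [|L2 sL2 [L2H HL2]] := IHD H2 d uD.
  move=> A uA AD shA; rewrite -ltnS.
  have xA : x \notin A by apply: contra xD => /AD.
  apply: (HD (x :: A)) => //=; first by rewrite xA.
    by move=> z; rewrite !inE => /orP[->//|/AD ->]; rewrite orbT.
  move=> b; have [h [Hh [h' Hh' [hh' h'x]]] hb] := shA b.
  have [bx|bx] := eqVneq (b x) (h x).
    by exists h => // z; rewrite inE => /orP[/eqP->//|/hb].
  exists h' => // z; rewrite inE => /orP[/eqP->|zA].
    by rewrite h'x; case: (b x) (h x) bx => [] [].
  by rewrite -hh' ?hb//; exact: AD.
have [|L3 sL3 [L23 L32]] := @seq_choice _ _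
    (fun h h' => H h' /\ {in D, h =1 h'} /\ h' x = ~~ h x) L2.
  by move=> h /L2H [_ [h' Hh' Hx]]; exists h'.
exists (L1 ++ L2 ++ L3).
  rewrite !size_cat sL3 addnn.
  apply: (@leq_trans ((size D).*2.+1 ^ d.+1 + ((size D).*2.+1 ^ d).*2)).
    by rewrite leq_add// leq_double.
  have -> : (size D).+1.*2.+1 = ((size D).*2.+1 + 2)%N by lia.
  rewrite [leqRHS]expnS mulnDl expnS leq_add//.
    by rewrite leq_mul2l leq_expl ?leq_addr ?orbT.
  by rewrite mul2n leq_double leq_expl ?leq_addr.
split=> [l /List.in_app_iff[/L1H//|/List.in_app_iff[/L2H[]//|/L32[h _ []//]]]|].
move=> h Hh; have [l lL1 hl] := HL1 h Hh.
have inx g : {in D, h =1 g} -> g x = h x -> {in x :: D, h =1 g}.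
  by move=> hg gx z; rewrite inE => /orP[/eqP->//|/hg].
(* If [l] differs from [h] at [x], then [l] flips [h], so [h] is in [H2]; its representative [g] or
   the flip [g'] has the right value at [x]. *)
have [lx|lx] := eqVneq (l x) (h x).
  by exists l; [apply/List.in_app_iff; left|exact: inx].
have [|g gL2 hg] := HL2 h.
  split=> //; exists l; [exact: L1H|split=> //].
  by case: (l x) (h x) lx => [] [].
have [gx|gx] := eqVneq (g x) (h x).
  exists g; last exact: inx.
  by apply/List.in_app_iff; right; apply/List.in_app_iff; left.
have [g' g'L3 [_ [gg' g'x]]] := L23 g gL2.
exists g'; first by apply/List.in_app_iff; right; apply/List.in_app_iff; right.
apply: inx => [z zD|]; first by rewrite hg ?gg'.
by rewrite g'x; case: (g x) (h x) gx => [] [].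
Qed.

Lemma VCdim_cover (H : set (X -> bool)) d D : is_VCdim H d ->
  exists2 L, (size L <= ((size D).*2.+1) ^ d)%N & traces_covered H D L.
Proof.
move=> [_ vcH]; have [|L sL [LH HL]] := @sauer H (undup D) d (undup_uniq D).
  move=> A uA _ shA; apply: (vcH _ [set` A]).
    have -> : [set` A] = [set` [fset x in A]%fset].
      by apply/seteqP; split=> x /=; rewrite inE.
    by apply/card_eq_fsetP; rewrite card_fseq undup_id.
  move=> B BA; have [h Hh hB] := shA (fun x => `[< B x >]).
  exists h => //; apply/seteqP; split=> [x [/= xA]|x Bx].
    by rewrite hB// => /asboolP.
  by have xA := BA _ Bx; split=> //=; rewrite hB//; exact/asboolP.
exists L.
  apply: (leq_trans sL).
  by rewrite leq_expl// ltnS leq_double size_undup.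
split=> // h /HL[l lL hl]; exists l => // x xD; apply: hl.
by rewrite mem_undup.
Qed.

End representatives.
(** * Uniform deviations over a discrete sample space *)

Section iterated_integral.
Context (R : realType) (Q : probability nat R).
Local Open Scope ereal_scope.
Implicit Types (f g : seq nat -> \bar R).

Lemma measurable_fun_nat2 (d : measure_display) (T : measurableType d)
  (f : nat * nat -> T) : measurable_fun setT f.
Proof.
move=> _ Y _; rewrite setTI.
rewrite (_ : _ @^-1` _ = \bigcup_(u in f @^-1` Y) ([set u.1] `*` [set u.2])).
  rewrite bigcup_mkcond; apply: countable_bigcupT_measurable => // u.
  by case: ifP => // _; exact: measurableX.
apply/seteqP; split=> [[i j] /= Yij|[i j] [[k l] /= Ykl [/= -> ->]]//].
by exists (i, j).
Qed.

(** Expectation under the [n]-fold product of [Q]. Over [nat] every integrand is measurable, even a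
    supremum over an uncountable class. *)
Fixpoint iter_int (n : nat) (f : seq nat -> \bar R) : \bar R :=
  match n with
  | 0%N => f [::]
  | n'.+1 => \int[Q]_i iter_int n' (fun s => f (i :: s))
  end.

Lemma iter_int_ge0 n f : (forall s, size s = n -> 0 <= f s) ->
  0 <= iter_int n f.
Proof.
elim: n f => [|n IHn] f f0 /=; first exact: f0.
by apply: integral_ge0 => i _; apply: IHn => s sn; apply: f0; rewrite /= sn.
Qed.

Lemma le_iter_int n f g : (forall s, size s = n -> 0 <= f s) ->
  (forall s, size s = n -> f s <= g s) -> iter_int n f <= iter_int n g.
Proof.
elim: n f g => [|n IHn] f g f0 fg /=; first exact: fg.
apply: ge0_le_integral => //.
- by move=> i _; apply: iter_int_ge0 => s sn; apply: f0; rewrite /= sn.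
- by move=> i _; apply: IHn => s sn; [apply: f0|apply: fg]; rewrite /= sn.
Qed.

Lemma eq_iter_int n f g : (forall s, size s = n -> f s = g s) ->
  iter_int n f = iter_int n g.
Proof.
elim: n f g => [|n IHn] f g fg /=; first exact: fg.
by apply: eq_integral => i _; apply: IHn => s sn; apply: fg; rewrite /= sn.
Qed.

Lemma iter_intZ n f (c : R) : (0 <= c)%R -> (forall s, 0 <= f s) ->
  iter_int n (fun s => c%:E * f s) = c%:E * iter_int n f.
Proof.
move=> c0; elim: n f => [//|n IHn] f f0 /=.
rewrite -ge0_integralZl//; last by move=> i _; exact: iter_int_ge0.
by apply: eq_integral => i _; rewrite IHn.
Qed.

Lemma iter_intD n f g : (forall s, 0 <= f s) -> (forall s, 0 <= g s) ->
  iter_int n (fun s => f s + g s) = iter_int n f + iter_int n g.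
Proof.
elim: n f g => [//|n IHn] f g f0 g0 /=.
rewrite -ge0_integralD//; [|by move=> i _; exact: iter_int_ge0..].
by apply: eq_integral => i _; rewrite IHn.
Qed.

Lemma integral_nat_swap (f : nat -> nat -> \bar R) : (forall i j, 0 <= f i j) ->
  \int[Q]_i \int[Q]_j f i j = \int[Q]_j \int[Q]_i f i j.
Proof.
move=> f0; pose f' u := f u.1 u.2.
have mf' : measurable_fun setT f' by exact: measurable_fun_nat2.
exact: (fubini_tonelli f' mf' (fun u => f0 u.1 u.2)).
Qed.

Lemma iter_int_swap n (f : nat -> seq nat -> \bar R) :
  (forall i s, 0 <= f i s) ->
  iter_int n (fun s => \int[Q]_i f i s) = \int[Q]_i iter_int n (f i).
Proof.
elim: n f => [//|n IHn] f f0 /=.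
rewrite -integral_nat_swap; last by move=> i j; exact: iter_int_ge0.
by apply: eq_integral => i _; rewrite IHn.
Qed.

(** Generating function of a Bernoulli variable; [a = 0] is allowed, with [0 ^+ 0 = 1], and yields
    the probability of no error. *)
Lemma integral_bool_weight (f : nat -> bool) (a : R) : (0 <= a)%R ->
  \int[Q]_i (a ^+ f i)%:E = (1 + (a - 1) * fine (Q [set i | f i]))%:E.
Proof.
move=> a0; pose A : set nat := [set i | f i].
have QA : Q A = (fine (Q A))%:E by rewrite fineK// fin_num_measure.
have QAC : Q (~` A) = (1 - fine (Q A))%:E by rewrite probability_setC// QA.
transitivity (\int[Q]_i ((\1_(~` A) i)%:E + a%:E * (\1_A i)%:E)).
  apply: eq_integral => i _; rewrite !indicE in_setC.
  have -> : (i \in A) = f i by apply/idP/idP => [/set_mem//|fi]; exact: mem_set.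
  by case: (f i); rewrite /= ?mule1 ?mule0 ?add0e ?adde0 ?expr1 ?expr0.
rewrite ge0_integralD//; try by move=> i _; rewrite ?mule_ge0// lee_fin.
rewrite ge0_integralZl//; try by move=> i _; rewrite lee_fin.
rewrite !integral_indic// !setIT.
transitivity ((1 - fine (Q A))%:E + a%:E * (fine (Q A))%:E).
  by congr (_ + _ * _); [exact: QAC|exact: QA].
by rewrite -EFinM -EFinD; congr EFin; rewrite /A; ring.
Qed.

Lemma iter_int_count n (f : nat -> bool) (a : R) : (0 <= a)%R ->
  iter_int n (fun s => (a ^+ count f s)%:E) =
  ((1 + (a - 1) * fine (Q [set i | f i])) ^+ n)%:E.
Proof.
move=> a0; elim: n => [//|n IHn] /=.
under eq_integral => i _ do under eq_iter_int => s _ do rewrite exprD EFinM.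
under eq_integral => i _.
  rewrite iter_intZ ?exprn_ge0//; last by move=> s; rewrite lee_fin exprn_ge0.
  rewrite IHn muleC.
  over.
rewrite ge0_integralZl//.
- by rewrite integral_bool_weight// -EFinM exprSr.
- by move=> i _; rewrite lee_fin exprn_ge0.
- have p1 : (fine (Q [set i | f i]) <= 1)%R.
    by rewrite -lee_fin fineK ?fin_num_measure// probability_le1.
  rewrite lee_fin exprn_ge0// mulrBl mul1r addrCA addr_ge0//.
    by rewrite mulr_ge0// fine_ge0.
  by rewrite subr_ge0.
Qed.

End iterated_integral.

(** * Symmetrization with a ghost sample *)

Section symmetrization.
Context (R : realType).
Local Open Scope ereal_scope.
Implicit Types (Phi Psi : seq nat -> seq nat -> \bar R) (s u : seq nat).

(** The sum over all coordinatewise swaps, that is, [2 ^+ n] times the expectation under random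
    signs for lists of length [n]. *)
Fixpoint swap_sum s s' Phi : \bar R :=
  match s, s' with
  | i :: t, j :: t' => swap_sum t t' (fun u u' => Phi (i :: u) (j :: u')) +
                       swap_sum t t' (fun u u' => Phi (j :: u) (i :: u'))
  | _, _ => Phi [::] [::]
  end.

Lemma swap_sum_ge0 s s' Phi : (forall u u', 0 <= Phi u u') ->
  0 <= swap_sum s s' Phi.
Proof.
elim: s s' Phi => [|i s IHs] [|j s'] Phi Phi0 //=.
by rewrite adde_ge0// IHs.
Qed.

(** Swapping never creates new entries, so a comparison on the points of [s ++ s'] is enough; there
    finitely many traces cover the class. *)
Lemma le_swap_sum s s' Phi Psi :
  (forall u u', {subset u ++ u' <= s ++ s'} -> Phi u u' <= Psi u u') ->
  swap_sum s s' Phi <= swap_sum s s' Psi.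
Proof.
elim: s s' Phi Psi => [|i s IHs] [|j s'] Phi Psi le_Phi /=;
  [by apply: le_Phi..|].
apply: leeD; apply: IHs => u u' uu'; apply: le_Phi => k;
  rewrite !mem_cat !in_cons => kuu';
  have := uu' k; rewrite !mem_cat;
  by case: (k == i) kuu'; case: (k == j); case: (k \in u); case: (k \in u');
    case: (k \in s); case: (k \in s') => //= _ /(_ isT).
Qed.

Lemma swap_sumD s s' Phi Psi :
  swap_sum s s' (fun u u' => Phi u u' + Psi u u') =
  swap_sum s s' Phi + swap_sum s s' Psi.
Proof.
elim: s s' Phi Psi => [|i s IHs] [|j s'] Phi Psi //=.
by rewrite !IHs addeACA.
Qed.

Lemma swap_sum_sum s s' (T : Type) (L : seq T)
    (Psi : T -> seq nat -> seq nat -> \bar R) :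
  swap_sum s s' (fun u u' => \sum_(g <- L) Psi g u u') =
  \sum_(g <- L) swap_sum s s' (Psi g).
Proof.
elim: L => [|g L IHL].
  rewrite big_nil (_ : (fun _ _ => _) = (fun _ _ => 0)); last first.
    by apply/funext => u; apply/funext => u'; rewrite big_nil.
  by elim: s s' => [|i s IHs] [|j s'] //=; rewrite IHs adde0.
rewrite big_cons -IHL -swap_sumD; congr swap_sum.
by apply/funext => u; apply/funext => u'; rewrite big_cons.
Qed.

Definition pair_weight (a b : R) (f : nat -> bool) s s' : R :=
  (b ^+ count f s * a ^+ count f s')%R.

(** The positions factor. The two orders of a pair contribute [2], [a + b] or [2 * a * b] when [f]
    holds at none, one or both of its entries, each at most [2 * M]. The factor [k] carries the
    positions already treated through the induction. *)
Lemma swap_sum_weight s s' (f : nat -> bool) (a b M k : R) :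
  (0 <= a)%R -> (0 <= b)%R -> (0 <= k)%R ->
  (1 <= M)%R -> (a + b <= 2 * M)%R -> (a * b <= M)%R -> size s = size s' ->
  swap_sum s s' (fun u u' => (k * pair_weight a b f u u')%:E) <=
  (k * (2 * M) ^+ size s)%:E.
Proof.
move=> a0 b0 + M1 abM abM'.
elim: s s' k => [|i s IHs] [|j s'] k k0 //=.
  by move=> _; rewrite lee_fin /pair_weight /= !expr0 mulr1.
move=> [ss'].
have wE x y : (fun u u' => (k * pair_weight a b f (x :: u) (y :: u'))%:E) =
    (fun u u' => (k * (b ^+ f x * a ^+ f y) * pair_weight a b f u u')%:E).
  apply/funext => u; apply/funext => u'; congr EFin.
  by rewrite /pair_weight /= !exprD; ring.
rewrite !wE; apply: (le_trans (leeD (IHs _ _ _ ss') (IHs _ _ _ ss'))).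
- by rewrite !mulr_ge0// exprn_ge0.
- by rewrite !mulr_ge0// exprn_ge0.
rewrite -EFinD lee_fin exprS -!mulrA -mulrDr ler_wpM2l// !mulrA -!mulrDl.
apply: ler_wpM2r; first by rewrite exprn_ge0// mulr_ge0// (le_trans _ M1).
by case: (f i); case: (f j); rewrite /= ?expr0 ?expr1; lra.
Qed.

Lemma sum_ge_In (T : Type) (L : seq T) (w : T -> \bar R) g :
  (forall h, 0 <= w h) -> List.In g L -> w g <= \sum_(h <- L) w h.
Proof.
move=> w0; elim: L => [//|h L IHL] /= [->|gL]; rewrite big_cons.
  by rewrite leeDl// sume_ge0.
by apply: (le_trans (IHL gL)); rewrite leeDr.
Qed.

Definition sup_weight (F : set (nat -> bool)) (a b : R) s s' : \bar R :=
  ereal_sup [set (pair_weight a b f s s')%:E | f in F].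

(** Lists of length [n + n] are a sample followed by its ghost sample. *)
Definition cover_size (F : set (nat -> bool)) (n : nat) (G : R) :=
  forall s, size s = (n + n)%N -> exists2 L : seq (nat -> bool),
    ((size L)%:R <= G)%R & forall f, F f -> exists2 g, List.In g L & {in s, f =1 g}.

(** A union bound: on the entries of [s ++ s'] the supremum is dominated by the sum over at most [G]
    representatives. *)
Lemma swap_sum_sup_weight F n s s' (a b M G : R) :
  cover_size F n G -> (0 <= a)%R -> (0 <= b)%R ->
  (1 <= M)%R -> (a + b <= 2 * M)%R -> (a * b <= M)%R ->
  size s = n -> size s' = n ->
  swap_sum s s' (sup_weight F a b) <= (G * (2 * M) ^+ n)%:E.
Proof.
move=> cF a0 b0 M1 abM abM' sn s'n.
have w0 f u u' : (0 <= pair_weight a b f u u')%R.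
  by rewrite mulr_ge0// exprn_ge0.
have [|L LG FL] := cF (s ++ s'); first by rewrite size_cat sn s'n.
apply: (@le_trans _ _ (swap_sum s s'
    (fun u u' => \sum_(g <- L) (1 * pair_weight a b g u u')%:E))).
  apply: le_swap_sum => u u' uu'; apply: ge_ereal_sup => _ [f Ff <-].
  have [g gL fg] := FL _ Ff.
  have -> : pair_weight a b f u u' = (1 * pair_weight a b g u u')%R.
    rewrite mul1r /pair_weight; congr (_ ^+ _ * _ ^+ _)%R;
      apply: eq_in_count => k ku; apply: fg; apply: uu';
      by rewrite mem_cat ku ?orbT.
  apply: (sum_ge_In _ gL) => h.
  by rewrite lee_fin mul1r.
rewrite swap_sum_sum.
apply: (@le_trans _ _ (\sum_(g <- L) ((2 * M) ^+ n)%:E)).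
  apply: lee_sum => g _; rewrite -[leRHS]mul1e -sn -EFinM.
  by apply: swap_sum_weight; rewrite ?sn.
rewrite sumEFin lee_fin big_const_seq count_predT iter_addr_0 -[leLHS]mulr_natl.
by rewrite ler_wpM2r// exprn_ge0// mulr_ge0// (le_trans _ M1).
Qed.

Context (Q : probability nat R).

Lemma iter_int_cst n (c : R) : iter_int Q n (cst c%:E) = c%:E.
Proof.
elim: n => [//|n IHn] /=.
under eq_integral do rewrite IHn.
by rewrite integral_cst// -[RHS]mule1; congr (_ * _); exact: probability_setT.
Qed.

Lemma iter_int_setU n (B1 B2 : set (seq nat)) :
  iter_int Q n (fun s => (\1_(B1 `|` B2) s)%:E) <=
  iter_int Q n (fun s => (\1_B1 s)%:E) + iter_int Q n (fun s => (\1_B2 s)%:E).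
Proof.
rewrite -iter_intD//; try by move=> s; rewrite lee_fin.
apply: le_iter_int => s _; first by rewrite lee_fin.
rewrite !indicE in_setU -EFinD lee_fin -natrD ler_nat.
by case: (s \in B1); case: (s \in B2).
Qed.

Lemma iter_int2S n Phi : (forall u u', 0 <= Phi u u') ->
  iter_int Q n.+1 (fun s => iter_int Q n.+1 (Phi s)) =
  \int[Q]_i \int[Q]_j
    iter_int Q n (fun s => iter_int Q n (fun s' => Phi (i :: s) (j :: s'))).
Proof.
move=> Phi0 /=; apply: eq_integral => i _.
by rewrite iter_int_swap// => j s; exact: iter_int_ge0.
Qed.

(** Exchangeability: the entries of both samples in a given position are independent with the same
    law, so each of the [2 ^+ n] swaps leaves the double integral unchanged. *)
Lemma iter_int2_swap n Phi : (forall u u', 0 <= Phi u u') ->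
  iter_int Q n (fun s => iter_int Q n (fun s' => swap_sum s s' Phi)) =
  (2 ^+ n)%:E * iter_int Q n (fun s => iter_int Q n (Phi s)).
Proof.
elim: n Phi => [|n IHn] Phi Phi0; first by rewrite mul1e.
rewrite !iter_int2S//; last by move=> s s'; exact: swap_sum_ge0.
pose J i j := iter_int Q n
  (fun s => iter_int Q n (fun s' => Phi (i :: s) (j :: s'))).
have J0 i j : 0 <= J i j.
  by apply: iter_int_ge0 => s _; exact: iter_int_ge0.
transitivity (\int[Q]_i \int[Q]_j ((2 ^+ n)%:E * (J i j + J j i))).
  apply: eq_integral => i _; apply: eq_integral => j _ /=.
  rewrite ge0_muleDr// -!IHn// -iter_intD.
  - by apply: eq_iter_int => s _; rewrite iter_intD// => u; exact: swap_sum_ge0.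
  - by move=> s; apply: iter_int_ge0 => s' _; exact: swap_sum_ge0.
  - by move=> s; apply: iter_int_ge0 => s' _; exact: swap_sum_ge0.
transitivity (\int[Q]_i ((2 ^+ n)%:E * (\int[Q]_j J i j + \int[Q]_j J j i))).
  apply: eq_integral => i _; rewrite ge0_integralZl//.
  - by rewrite ge0_integralD.
  - by move=> j _; rewrite adde_ge0.
rewrite ge0_integralZl//; last by move=> i _; rewrite adde_ge0// integral_ge0.
rewrite ge0_integralD//; [|by move=> i _; exact: integral_ge0..].
rewrite [X in _ + X]integral_nat_swap//.
rewrite exprS EFinM -muleA [RHS]muleCA; congr (_ * _).
by rewrite mule_natl mule2n.
Qed.

(* If [p] is the probability of [f], then [(1 + (a - 1) * p) ^+ n] is the
   average of [a ^+ count f s'] over a ghost sample [s'], so that the weights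
   of the sample and of the ghost sample can be symmetrized together, without
   restricting to an event on which the ghost sample is typical. *)
Lemma uniform_tail (F : set (nat -> bool)) n (a b M G c : R)
    (B : set (seq nat)) :
  cover_size F n G -> (0 <= a)%R -> (0 <= b)%R ->
  (1 <= M)%R -> (a + b <= 2 * M)%R -> (a * b <= M)%R -> (0 < c)%R ->
  (exists f, F f) ->
  (forall s, B s -> size s = n -> exists2 f, F f &
    (c <= b ^+ count f s * (1 + (a - 1) * fine (Q [set i | f i])) ^+ n)%R) ->
  iter_int Q n (fun s => (\1_B s)%:E) <= (G * M ^+ n / c)%:E.
Proof.
move=> cF a0 b0 M1 abM abM' c0 [f0 Ff0] BF.
pose Phi := sup_weight F a b.
have Phi_ge f s s' : F f -> (pair_weight a b f s s')%:E <= Phi s s'.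
  by move=> Ff; apply: ereal_sup_ubound; exists f.
have w0 f u u' : (0 <= pair_weight a b f u u')%R.
  by rewrite mulr_ge0// exprn_ge0.
(* A member of [F] is needed here: the supremum over an empty class is [-oo]. *)
have Phi0 s s' : 0 <= Phi s s'.
  by apply: le_trans (Phi_ge f0 s s' Ff0); rewrite lee_fin.
have M0 : (0 <= M)%R by rewrite (le_trans _ M1).
have I0 : 0 <= iter_int Q n (fun s => (\1_B s)%:E).
  by apply: iter_int_ge0 => s _; rewrite lee_fin.
(* Markov's inequality: on [B] the inner integral over the ghost sample is at least [c]. *)
have le1 : c%:E * iter_int Q n (fun s => (\1_B s)%:E) <=
    iter_int Q n (fun s => iter_int Q n (Phi s)).
  rewrite -iter_intZ ?(ltW c0)//.
  apply: le_iter_int => s sn; first by rewrite -EFinM lee_fin mulr_ge0// ltW.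
  rewrite indicE; case: (boolP (s \in B)) => [/set_mem Bs|_]; last first.
    by rewrite mule0 iter_int_ge0.
  rewrite mule1; have [f Ff cf] := BF s Bs sn.
  apply: (@le_trans _ _ (iter_int Q n (fun s' => (pair_weight a b f s s')%:E))).
    under eq_iter_int => s' _ do rewrite EFinM.
    rewrite iter_intZ ?exprn_ge0//; last by move=> s'; rewrite lee_fin exprn_ge0.
    by rewrite iter_int_count// -EFinM lee_fin.
  by apply: le_iter_int => s' _; [rewrite lee_fin|exact: Phi_ge].
have le2 : (2 ^+ n)%:E * iter_int Q n (fun s => iter_int Q n (Phi s)) <=
    (G * (2 * M) ^+ n)%:E.
  rewrite -iter_int2_swap//.
  apply: (@le_trans _ _ (iter_int Q n (cst (G * (2 * M) ^+ n)%:E))); last first.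
    by rewrite iter_int_cst.
  apply: le_iter_int => s sn.
    by apply: iter_int_ge0 => s' _; exact: swap_sum_ge0.
  apply: (@le_trans _ _ (iter_int Q n (cst (G * (2 * M) ^+ n)%:E))); last first.
    by rewrite iter_int_cst.
  apply: le_iter_int => s' s'n; first exact: swap_sum_ge0.
  exact: swap_sum_sup_weight.
rewrite -lee_pdivlMl ?exprn_gt0// in le2.
rewrite -(@lee_pmul2l _ c%:E)// ?fin_numE// ?lte_fin//.
apply: (le_trans le1); apply: (le_trans le2).
rewrite -!EFinM lee_fin exprMn.
have -> : (c * (G * M ^+ n / c) = G * M ^+ n)%R.
  by rewrite mulrCA divff ?mulr1// gt_eqF.
have -> : ((2 ^+ n)^-1 * (G * (2 ^+ n * M ^+ n)) = G * M ^+ n)%R.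
  by rewrite mulrCA !mulrA mulfVK// expf_neq0.
by [].
Qed.

End symmetrization.

(** * Exponential deviation bounds *)

Section deviation.
Context (R : realType).
Implicit Types (t p eps : R).

(** From [1 + x <= expR x] alone: the left side is at most [2 / (1 - t ^+ 2)]. The exponent is not
    the sharp [t ^+ 2 / 2], which only affects absolute constants. *)
Lemma expRDexpRN_le t : 0 <= t <= 1 / 2 ->
  expR t + expR (- t) <= 2 * expR (2 * t ^+ 2).
Proof.
move=> /andP[t0 t12]; set a := expR t; set b := expR (- t).
have ab : a * b = 1 by rewrite -expRD subrr expR0.
have b1 : 1 - t <= b := expR_ge1Dx (- t).
have a1 : 1 + t <= a := expR_ge1Dx t.
have a0 : 0 < a by exact: expR_gt0.
have b0 : 0 < b by exact: expR_gt0.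
have aM : a * (1 - t) <= 1 by rewrite -[leRHS]ab ler_wpM2l// ltW.
have bM : b * (1 + t) <= 1 by rewrite -[leRHS]ab mulrC ler_wpM2r// ltW.
have aM' : a <= (1 - t)^-1 by rewrite -[leRHS]mul1r ler_pdivlMr//; lra.
have bM' : b <= (1 + t)^-1 by rewrite -[leRHS]mul1r ler_pdivlMr//; lra.
have M1 := expR_ge1Dx (2 * t ^+ 2).
have u0 : 0 < 1 - t ^+ 2 by nra.
apply: (@le_trans _ _ (2 * (1 - t ^+ 2)^-1)).
  have -> : 2 * (1 - t ^+ 2)^-1 = (1 - t)^-1 + (1 + t)^-1.
    field; apply/andP; split; last by apply/andP; split; apply/eqP; nra.
    by apply/eqP; nra.
  exact: lerD.
rewrite ler_pM2l//; apply: le_trans M1.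
rewrite -[leLHS]mul1r ler_pdivrMr//.
have : 0 <= t ^+ 2 by exact: sqr_ge0.
have : t ^+ 2 <= 1 / 4 by nra.
set u := t ^+ 2; nra.
Qed.

(** Convexity of [expR], obtained by averaging its tangent at [t * p] over the endpoints 0 and [t]
    with weights [1 - p] and [p]. *)
Lemma expR_bernoulli_le p t : 0 <= p <= 1 ->
  expR (t * p) <= 1 + (expR t - 1) * p.
Proof.
move=> /andP[p0 p1]; set x := t * p; set e := expR x.
have e0 : 0 <= e by exact: expR_ge0.
have h0 : e * (1 - x) <= 1.
  have ex : e * expR (- x) = 1 by rewrite -expRD subrr expR0.
  by rewrite -[leRHS]ex ler_wpM2l// expR_ge1Dx.
have ht : e * (1 + (t - x)) <= expR t.
  have ex : e * expR (t - x) = expR t by rewrite -expRD addrC subrK.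
  by rewrite -[leRHS]ex ler_wpM2l// expR_ge1Dx.
have -> : 1 + (expR t - 1) * p = (1 - p) * 1 + p * expR t by ring.
have -> : e = (1 - p) * (e * (1 - x)) + p * (e * (1 + (t - x))).
  by rewrite /x; ring.
by rewrite lerD// ler_wpM2l// subr_ge0.
Qed.

Lemma expR_half_le eps : 0 <= eps <= 1 -> expR (eps / 2) <= 1 + eps.
Proof.
move=> /andP[e0 e1].
have h : 1 - eps / 2 <= expR (- (eps / 2)) := expR_ge1Dx _.
have : expR (eps / 2) * (1 - eps / 2) <= 1.
  have ex : expR (eps / 2) * expR (- (eps / 2)) = 1.
    by rewrite -expRD subrr expR0.
  by rewrite -[leRHS]ex ler_wpM2l// expR_ge0.
have := expR_ge0 (eps / 2); set e := expR _; nra.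
Qed.

Context (Q : probability nat R).
Local Notation pr f := (fine (Q [set i | f i])).
Local Notation prob n B := (iter_int Q n (fun s => (\1_B s)%:E)).

Lemma pr_ge0_le1 (f : nat -> bool) : 0 <= pr f <= 1.
Proof.
rewrite fine_ge0//= -lee_fin fineK ?fin_num_measure//.
exact: probability_le1.
Qed.

(** Weights [a = 2], [b = 0], [M = 1]: only samples without error keep a weight, [0 ^+ 0 = 1], and
    then [(1 + pr f) ^+ n] is at least [expR (eps / 2) ^+ n]. *)
Lemma realizable_deviation (F : set (nat -> bool)) n G eps :
  cover_size F n G -> (exists f, F f) -> 0 < eps < 1 ->
  (prob n [set s | exists f, [/\ F f, count f s = 0%N & eps < pr f]%R] <=
   (G * expR (- (n%:R * eps / 2)))%:E)%E.
Proof.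
move=> cF F0 /andP[e0 e1].
have G0 : 0 <= G.
  have [|L LG _] := cF (nseq (n + n) 0%N); first by rewrite size_nseq.
  exact: le_trans LG.
have -> : (G * expR (- (n%:R * eps / 2))) =
          G * 1 ^+ n / expR (eps / 2) ^+ n.
  by rewrite expr1n mulr1 -expRM_natl expRN mulrA.
apply: (@uniform_tail R Q F n 2 0 1) => //; try lra.
  by rewrite exprn_gt0// expR_gt0.
move=> s [f [Ff fs pf]] _; exists f => //.
rewrite fs expr0 mul1r; apply: lerXn2r; rewrite ?nnegrE ?expR_ge0//.
  by lra.
by apply: (le_trans (expR_half_le _)); lra.
Qed.

Lemma agnostic_deviation (F : set (nat -> bool)) n G eps :
  cover_size F n G -> (exists f, F f) -> 0 < eps < 1 ->
  (prob n [set s | exists2 f, F f &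
     ((count f s)%:R + n%:R * eps < n%:R * pr f)%R] <=
   (G * expR (- (n%:R * eps ^+ 2 / 8)))%:E)%E.
Proof.
move=> cF F0 /andP[e0 e1].
(* This [t] minimizes the exponent [2 * t ^+ 2 - t * eps], with value [- eps ^+ 2 / 8]. *)
pose t := eps / 4.
have -> : (G * expR (- (n%:R * eps ^+ 2 / 8))) =
          G * expR (2 * t ^+ 2) ^+ n / expR (t * (n%:R * eps)).
  rewrite -[RHS]mulrA -expRM_natl -expRN -expRD; congr (_ * expR _).
  by rewrite /t; field.
apply: (@uniform_tail R Q F n (expR t) (expR (- t))) => //.
- by rewrite -[leLHS]expR0 ler_expR mulr_ge0// sqr_ge0.
- by apply: expRDexpRN_le; rewrite /t; apply/andP; split; lra.
- by rewrite -expRD subrr ler_expR mulr_ge0// sqr_ge0.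
- exact: expR_gt0.
move=> s [f Ff pf] _; exists f => //.
have p01 := pr_ge0_le1 f.
apply: (@le_trans _ _ (expR (- t) ^+ count f s * expR (t * pr f) ^+ n)).
  rewrite -!expRM_natl -expRD ler_expR.
  have -> : (count f s)%:R * - t + n%:R * (t * pr f) =
            t * (n%:R * pr f - (count f s)%:R) by ring.
  by rewrite ler_wpM2l /t//; lra.
rewrite ler_wpM2l ?exprn_ge0 ?expR_ge0//.
apply: lerXn2r; rewrite ?nnegrE ?expR_ge0//.
  by apply: le_trans (expR_bernoulli_le t p01); exact: expR_ge0.
exact: expR_bernoulli_le.
Qed.

(** One fixed [f] holds too often exactly when its negation holds too rarely, and the negation alone
    has a single trace. The condition on [size s] lets the two counts add up to [n]. *)
Lemma upper_deviation (f : nat -> bool) n eps : 0 < eps < 1 ->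
  (prob n [set s | size s = n /\
     (n%:R * pr f + n%:R * eps < (count f s)%:R)%R] <=
   (expR (- (n%:R * eps ^+ 2 / 8)))%:E)%E.
Proof.
move=> e01; pose g i := ~~ f i.
have cg : cover_size [set g] n (1 : R).
  move=> s _; exists [:: g] => // _ ->.
  by exists g => //; left.
have pg : pr g = 1 - pr f.
  have -> : [set i | g i] = ~` [set i | f i].
    by apply/seteqP; split=> i /=; rewrite /g => /negP.
  by rewrite probability_setC// fineB// ?fin_num_measure.
rewrite -[expR _]mul1r.
have g0 : exists h, [set g] h by exists g.
apply: le_trans (agnostic_deviation cg g0 e01).
apply: le_iter_int => s sn; rewrite lee_fin// !indicE.
case: (boolP (s \in [set s0 | _ ])) => // /set_mem/= [_ h].
rewrite (_ : (s \in _) = true)//; apply/mem_set; exists g => //=.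
rewrite pg; have /(congr1 (fun k => k%:R : R)) := count_predC f s.
rewrite sn natrD -/g.
have -> : count (predC f) s = count g s by [].
move=> E; lra.
Qed.

(* The infimum of the probabilities over F need not be attained. *)
Lemma consistent_ae (F : set (nat -> bool)) n :
  (forall e, 0 < e -> exists2 f, F f & pr f < e) ->
  prob n [set s | forall f, F f -> (0 < count f s)%N] = 0%E.
Proof.
move=> F0; set B := [set s | _].
have B0 : (0 <= prob n B)%E by apply: iter_int_ge0 => s _; rewrite lee_fin.
apply/eqP; rewrite eq_le B0 andbT; apply/lee_addgt0Pr => e e0; rewrite add0e.
(* Dividing by [n.+1] rather than [n] also covers the empty sample. *)
have [|f Ff fe] := F0 (e / n.+1%:R); first by rewrite divr_gt0.
have /andP[p0 p1] := pr_ge0_le1 f.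
have bern : 1 - e <= (1 - pr f) ^+ n.
  have h k : 1 - k%:R * pr f <= (1 - pr f) ^+ k.
    elim: k => [|k IHk]; first by rewrite mul0r subr0 expr0.
    rewrite exprS; apply: le_trans (ler_wpM2l _ IHk); last by lra.
    rewrite -natr1; have : 0 <= k%:R * pr f * pr f by rewrite !mulr_ge0.
    lra.
  apply: le_trans (h n); rewrite lerD2l lerN2.
  apply: (@le_trans _ _ (n.+1%:R * pr f)).
    by rewrite ler_wpM2r// ler_nat.
  by rewrite mulrC -ler_pdivlMr// ltW.
(* [0 ^+ count f s] is the indicator of the samples on which [f] makes no error, an event disjoint
   from [B] and of probability [(1 - pr f) ^+ n]. *)
have : (prob n B + iter_int Q n (fun s => (0 ^+ count f s)%:E) <= 1%:E)%E.
  rewrite -iter_intD; first last.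
  - by move=> s; rewrite lee_fin exprn_ge0.
  - by move=> s; rewrite lee_fin.
  rewrite -(iter_int_cst Q n 1); apply: le_iter_int => s _.
    by rewrite -EFinD lee_fin addr_ge0// exprn_ge0.
  rewrite -EFinD lee_fin indicE expr0n.
  case: (boolP (s \in B)) => [/set_mem /(_ f Ff)|_].
    by rewrite lt0n => /negPf ->; rewrite addr0.
  by rewrite add0r lern1 leq_b1.
rewrite iter_int_count// sub0r mulN1r.
have Bfin : prob n B \is a fin_num.
  rewrite ge0_fin_numE//; apply: (@le_lt_trans _ _ 1%E); last exact: ltry.
  rewrite -(iter_int_cst Q n 1); apply: le_iter_int => s _.
    by rewrite lee_fin.
  by rewrite lee_fin indicE lern1 leq_b1.
rewrite -(fineK Bfin) -EFinD !lee_fin; lra.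
Qed.

End deviation.

(** * Sample sizes *)

Lemma mulnSX_le (n k m : nat) : (0 < n)%N -> (2 <= m)%N -> (k <= m)%N ->
  ((4 * n * k).+1 <= m ^ 4 * n)%N.
Proof.
move=> n0 m2 km; have nm : (0 < n * m)%N by rewrite muln_gt0 n0 (leq_trans _ m2).
(* The fifth [n * m] absorbs the successor, and [5 <= 2 ^ 3 <= m ^ 3]. *)
apply: (@leq_trans (5 * (n * m))).
  have : (n * k <= n * m)%N by rewrite leq_mul2l km orbT.
  by rewrite -mulnA; move: (n * k)%N (n * m)%N nm => x y; lia.
rewrite expnSr -mulnA [(m * n)%N]mulnC leq_mul2r.
by rewrite (@leq_trans (2 ^ 3)) ?orbT// leq_expl.
Qed.

Section sample_bound.
Context (R : realType).
Implicit Types (e delta g : R) (vc k n : nat).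

(* In VC dimension 0 the complexity can be arbitrarily small, when delta is
   close to 1, so that no sample at all may be required. *)
Definition sample_bound vc k e delta : nat :=
  let g := complexity vc k delta / e in
  if vc is 0%N then 0%N else (Num.truncn (2 ^+ 13 * g * ln (2 + g))).+1.

Lemma ln2_ge_half : 1 / 2 <= ln (2 : R).
Proof.
rewrite -[leLHS]expRK ler_ln ?posrE ?expR_gt0//.
by apply: le_trans (expR_half_le _) _; rewrite ?ler01 ?lexx//; lra.
Qed.

Lemma ln_maxn2_ge k : ln (2 : R) <= ln (maxn 2 k)%:R.
Proof.
by rewrite ler_ln ?posrE ?ltr0n ?(leq_trans _ (leq_maxl 2 k))// ler_nat leq_maxl.
Qed.

Lemma lnV_ge0 delta : 0 < delta < 1 -> 0 <= ln (1 / delta).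
Proof.
by move=> /andP[d0 d1]; rewrite ln_ge0// ler_pdivlMr// mul1r ltW.
Qed.

Lemma complexity_ge0 vc k delta : 0 < delta < 1 -> 0 <= complexity vc k delta.
Proof.
move=> d01; rewrite addr_ge0 ?lnV_ge0// mulr_ge0//.
by have := ln_maxn2_ge k; have := ln2_ge_half; lra.
Qed.

Lemma ln2D_ge g : 0 <= g -> ln 2 <= ln (2 + g).
Proof. by move=> g0; rewrite ler_ln ?posrE//; lra. Qed.

(** Beyond dimension 0, both [g] and [ln (2 + g)] are at least 1/2, so that doubling the constant
    [2 ^+ 13] absorbs the rounding up. *)
Lemma sample_bound_le vc k e delta : 0 < e < 1 -> 0 < delta < 1 ->
  (sample_bound vc k e delta)%:R <=
  2 ^+ 14 * (complexity vc k delta / e) *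
    ln (2 + complexity vc k delta / e) ^+ 1.
Proof.
move=> /andP[e0 e1] d01; set g := complexity vc k delta / e.
have g0 : 0 <= g by rewrite divr_ge0 ?complexity_ge0// ltW.
have L0 := ln2D_ge g0; have l2 := ln2_ge_half.
rewrite expr1 /sample_bound -/g; case: vc @g g0 L0 => [|vc] g g0 L0.
  have C0 : 0 <= 2 ^+ 14 :> R by rewrite exprn_ge0.
  by rewrite (mulr_ge0 (mulr_ge0 C0 g0))//; lra.
rewrite -natr1.
have C1 : 1 <= 2 ^+ 11 :> R by rewrite exprn_ege1// ler1n.
have C13 : 2 ^+ 13 = 2 ^+ 11 * 4 :> R by rewrite -[13%N]/(11 + 2)%N exprD expr2; congr (_ * _); lra.
have C14 : 2 ^+ 14 = 2 ^+ 11 * 8 :> R.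
  by rewrite -[14%N]/(11 + 3)%N exprD !exprS expr0; congr (_ * _); lra.
rewrite C13 C14; set C : R := 2 ^+ 11 in C1 *.
have x0 : 0 <= C * 4 * g * ln (2 + g).
  have C4 : 0 <= C * 4 by lra.
  by rewrite (mulr_ge0 (mulr_ge0 C4 g0))//; lra.
have tr := x0; rewrite -truncn_le in tr.
have g2 : 1 / 2 <= g.
  rewrite ler_pdivlMr//; apply: (@le_trans _ _ (complexity vc.+1 k delta)).
    have := lnV_ge0 d01; have := ln_maxn2_ge k; rewrite /complexity.
    set K := ln (maxn 2 k)%:R; move=> K2 D0.
    have v1 : 1 <= vc.+1%:R :> R by rewrite ler1n.
    have : 1 * (1 / 2) <= vc.+1%:R * K by apply: ler_pM; lra.
    lra.
  by [].
have : 1 / 4 <= g * ln (2 + g).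
  have : 1 / 2 * (1 / 2) <= g * ln (2 + g) by apply: ler_pM; lra.
  lra.
set x := g * ln (2 + g) => x4.
have Cx : 1 * (1 / 4) <= C * x by apply: ler_pM; lra.
have -> : C * 8 * g * ln (2 + g) = 8 * (C * x) by rewrite /x; ring.
have E : C * 4 * g * ln (2 + g) = 4 * (C * x) by rewrite /x; ring.
rewrite E in tr *; lra.
Qed.

Lemma ln_le_shift (x c : R) : 0 < x -> 0 < c -> ln x <= x / c + ln c.
Proof.
move=> x0 c0; have xc : 0 < x / c by rewrite divr_gt0.
have -> : ln x = ln (x / c) + ln c.
  by rewrite -lnM ?posrE// mulfVK// gt_eqF.
by rewrite lerD2r ltW// ln_sublinear.
Qed.

(* Turns a requirement of the form g * ln x <= x into x >= g * ln g. *)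
Lemma ln_self_bound g x : 0 <= g -> 0 < x ->
  144 * g * ln x <= x / 2 + 1440 * (g * ln (2 + g)).
Proof.
move=> g0 x0; have L0 := ln2D_ge g0; have l2 := ln2_ge_half.
set L := ln (2 + g) in L0 *.
(* The shift [c = 288 * (2 + g)] makes the linear term at most [x / 2], and [288 <= 2 ^+ 9] gives
   [ln c <= 10 * L]. *)
have c0 : 0 < 288 * (2 + g) by lra.
have lnc : ln (288 * (2 + g)) <= 10 * L.
  have -> : 10 * L = 9 * L + L by lra.
  rewrite lnM ?posrE; [|lra|lra].
  rewrite lerD2r; apply: (@le_trans _ _ (9 * ln 2)); last by rewrite ler_pM2l.
  by rewrite mulr_natl -lnXn// ler_ln ?posrE ?exprn_gt0//; lra.
apply: (@le_trans _ _ (144 * g * (x / (288 * (2 + g)) + 10 * L))).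
  apply: ler_wpM2l; first by rewrite mulr_ge0.
  by apply: (le_trans (ln_le_shift x0 c0)); rewrite lerD2l.
have -> : 144 * g * (x / (288 * (2 + g)) + 10 * L) =
    x / 2 * (g / (2 + g)) + 1440 * (g * L).
  by field; apply/eqP; lra.
rewrite lerD2r -[leRHS]mulr1 ler_wpM2l ?divr_ge0// ?(ltW x0)//.
by rewrite ler_pdivrMr ?mul1r; lra.
Qed.

(** Both rates use it, with [e] equal to [eps] or [eps ^+ 2]. The factor 2 leaves room for two bad
    events, and 72 is [8 * 3 ^+ 2], from the agnostic bound at [eps / 3]. *)
Lemma sample_bound_suff vc k n e delta : 0 < e < 1 -> 0 < delta < 1 ->
  (0 < vc)%N -> (sample_bound vc k e delta <= n)%N ->
  2 * ((4 * n * k).+1 ^ vc)%:R * expR (- (n%:R * e / 72)) <= delta.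
Proof.
move=> /andP[e0 e1] d01 vc0.
set g := complexity vc k delta / e.
have -> : sample_bound vc k e delta = (Num.truncn (2 ^+ 13 * g * ln (2 + g))).+1.
  by rewrite /sample_bound -/g; case: (vc) vc0.
move=> Nn; have n0 : (0 < n)%N by exact: leq_trans Nn.
have g0 : 0 <= g by rewrite divr_ge0 ?complexity_ge0// ltW.
have L0 := ln2D_ge g0; have l2 := ln2_ge_half.
have K0 := ln_maxn2_ge k; have D0 := lnV_ge0 d01.
set K := ln (maxn 2 k)%:R in K0; set D := ln (1 / delta) in D0; set L := ln (2 + g) in L0.
have n1 : 2 ^+ 13 * (g * L) <= n%:R.
  rewrite mulrA; apply/ltW/(lt_le_trans (truncnS_gt _)).
  by rewrite ler_nat.
(* [4320 = 2 * (720 + 1440)]: 720 pays for [360 * g], as [g <= 2 * (g * L)], and 1440 is the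
   constant of [ln_self_bound]. *)
have {}n1 : 4320 * (g * L) <= n%:R.
  apply: le_trans n1; apply: ler_wpM2r; first by rewrite mulr_ge0//; lra.
  by rewrite -natrX ler_nat.
have eg : e * g = vc%:R * K + D by rewrite mulrC /g mulfVK// gt_eqF.
have v1 : 1 <= vc%:R :> R by rewrite ler1n.
have np : 0 < n%:R :> R by rewrite ltr0n.
have ln4 : ln (4 * n * k).+1%:R <= 4 * K + ln n%:R.
  have -> : 4 * K + ln n%:R = ln ((maxn 2 k)%:R ^+ 4 * n%:R).
    have m0 : 0 < (maxn 2 k)%:R :> R by rewrite ltr0n leq_max.
    by rewrite lnM ?posrE ?exprn_gt0// lnXn// mulr_natl.
  rewrite ler_ln ?posrE ?ltr0n// -?natrX -?natrM ?ltr0n ?muln_gt0 ?expn_gt0 ?leq_max//.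
  by rewrite ler_nat mulnSX_le// ?leq_maxl ?leq_maxr.
have lnn := ln_self_bound g0 np.
(* Multiplied by [e / 72], the first term pays for [ln 2 + 4 * vc * K + D] and the second for
   [vc * ln n]. *)
have {lnn n1} gn : 360 * g + 144 * g * ln n%:R <= n%:R.
  have : g * (1 / 2) <= g * L by rewrite ler_wpM2l//; lra.
  move: lnn n1 g0; rewrite -/L; set x := 144 * g * _; set y := g * L; lra.
have [d0 d1] := andP d01.
have De : delta = expR (- D) by rewrite /D div1r lnV ?posrE// opprK lnK ?posrE.
rewrite [leRHS]De.
have -> : (2 : R) = expR (ln 2) by rewrite lnK ?posrE.
have -> : ((4 * n * k).+1 ^ vc)%:R = expR (vc%:R * ln (4 * n * k).+1%:R) :> R.
  by rewrite expRM_natl lnK ?posrE ?ltr0n// natrX.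
rewrite -!expRD ler_expR.
have h1 : vc%:R * ln (4 * n * k).+1%:R <= 4 * (vc%:R * K) + vc%:R * ln n%:R.
  rewrite mulrCA -mulrDr; exact: ler_wpM2l.
have h2 : ln 2 <= vc%:R * K.
  by rewrite -[leLHS]mul1r ler_pM//; lra.
have ln0 : 0 <= ln n%:R :> R by rewrite ln_ge0// ler1n.
have h3 : vc%:R * ln n%:R <= 2 * (e * g) * ln n%:R.
  rewrite ler_wpM2r// eg.
  have : vc%:R * (1 / 2) <= vc%:R * K by rewrite ler_wpM2l//; lra.
  lra.
have h4 : e * (360 * g + 144 * g * ln n%:R) <= e * n%:R by rewrite ler_wpM2l// ltW.
have h5 : e * (360 * g + 144 * g * ln n%:R) =
  360 * (e * g) + 72 * (2 * (e * g) * ln n%:R) by ring.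
have h6 : n%:R * e / 72 = (e * n%:R) / 72 by rewrite [n%:R * e]mulrC.
rewrite h6; lra.
Qed.

End sample_bound.
(** * Learning *)

(* Even if F is uncountable, the atoms of the sigma-algebra it generates are
   countable intersections, since F cannot separate two points with the same
   code. *)
Lemma discrete_factor (d : measure_display) (T : measurableType d)
    (F : set (T -> bool)) (code : T -> nat) :
  (forall f, F f -> measurable [set z | f z]) ->
  (forall z z', code z = code z' -> forall f, F f -> f z = f z') ->
  exists (phi : {mfun T >-> nat}) (rep : nat -> T),
    forall f, F f -> forall z, f (rep (phi z)) = f z.
Proof.
move=> mF codeF.
pose same z := [set z' | forall f, F f -> f z = f z'].
have same_eq z z' : same z z' -> same z = same z'.
  move=> zz'; apply/seteqP; split=> t zt f Ff.
    by rewrite -zz'// zt.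
  by rewrite zz'// zt.
pose rep i := xget point [set z | code z = i].
(* [code] need not be measurable; taking the code of a point chosen from the atom of [z] makes each
   nonempty fiber of [phi] an atom. *)
pose phi z := code (xget point (same z)).
have phiP z f : F f -> f (rep (phi z)) = f z.
  move=> Ff; have sz : same z (xget point (same z)).
    by apply: (@xgetI _ point _ z) => g.
  rewrite (sz f Ff); apply: codeF => //.
  exact: (@xgetI _ point [set t | code t = phi z] (xget point (same z))).
have mphi1 i : measurable (phi @^-1` [set i]).
  have [->//|/set0P[z0 /= phiz0]] := eqVneq (phi @^-1` [set i]) set0.
  have -> : phi @^-1` [set i] = same z0.
    apply/seteqP; split=> z /= => [phiz f Ff|zz0].
      by rewrite -(phiP z0)// -(phiP z)// phiz phiz0.
    by rewrite -phiz0 /phi (same_eq _ _ zz0).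
  (* One member of [F] per code suffices: all points with code [j] look alike to [F], so if one of
     them lies outside the atom, a single [f] separates them all from [z0]. *)
  have /choice[A AP] j : exists A : set T, [/\ measurable A, same z0 `<=` A &
      forall z, A z -> code z = j -> same z0 z].
    have [[zj [czj nzj]]|njz] :=
      pselect (exists zj, code zj = j /\ ~ same z0 zj); last first.
      exists setT; split=> // z _ cz; apply: contrapT => nz.
      by apply: njz; exists z.
    have [f [Ff fz]] : exists f, F f /\ f z0 <> f zj.
      apply: contrapT => nf; apply: nzj => f Ff; apply: contrapT => fz.
      by apply: nf; exists f.
    exists [set z | f z = f z0]; split=> [|z zz0|z /= fzz0 cz].
    - case: (f z0); first exact: mF.
      rewrite (_ : mkset _ = ~` [set z | f z]); first exact/measurableC/mF.
      by apply/seteqP; split=> z /=; [move=> ->|move/negP/negPf].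
    - by rewrite /= (zz0 f Ff).
    - by case: fz; rewrite -fzz0; apply: codeF => //; rewrite cz.
  rewrite (_ : same z0 = \bigcap_j A j).
    by apply: bigcap_measurableType => j _; have [] := AP j.
  apply/seteqP; split=> [z zz0 j _|z Az]; first by have [_ sub _] := AP j; exact: sub.
  by have [_ _] := AP (code z); apply; [exact: Az|].
have mphi : measurable_fun setT phi.
  move=> _ Y _; rewrite setTI (_ : _ @^-1` _ = \bigcup_(i in Y) phi @^-1` [set i]).
    by apply: bigcup_measurable => i _.
  by apply/seteqP; split=> [z Yz|z [i Yi /= ->]//]; exists (phi z).
pose X := isMeasurableFun.Build _ _ T nat phi mphi.
pose phi' : {mfun T >-> nat} := HB.pack phi X.
by exists phi', rep => f Ff z; exact: phiP.
Qed.

(** * Samples and their codes *)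

Section iid_map.
Context (d : measure_display) (T : measurableType d) (R : realType).
Context (P : probability T R) (phi : {mfun T >-> nat}).

(** There are countably many tuples of codes, so [B] may be arbitrary. *)
Lemma measurable_map_tuple n (B : set (seq nat)) :
  measurable [set S : n.-tuple T | B (map phi S)].
Proof.
rewrite (_ : mkset _ = \bigcup_(u in [set u : n.-tuple nat | B u])
    \bigcap_(i in [set: 'I_n]) [set S : n.-tuple T | phi (tnth S i) = tnth u i]).
  rewrite bigcup_mkcond; apply: countable_bigcupT_measurable => // u.
  case: ifP => // _; apply: fin_bigcap_measurable => // i _.
  have mphi : measurable (phi @^-1` [set tnth u i]).
    by rewrite -[X in measurable X]setTI; exact: measurable_funP.
  have := @measurable_tnth _ T n i measurableT _ mphi.
  by rewrite setTI.
apply/seteqP; split=> [S BS|S [u Bu uS]].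
  exists [tuple of map phi S] => //= i _ /=.
  by rewrite tnth_map.
rewrite /= (_ : map phi S = u)//.
have -> : u = [tuple of map phi S] by apply/eq_from_tnth => i; rewrite tnth_map uS.
by [].
Qed.

Lemma iid_map n (B : set (seq nat)) :
  iid P n [set S : n.-tuple T | B (map phi S)] =
  iter_int (distribution P phi) n (fun s => (\1_B s)%:E).
Proof.
elim: n B => [|n IHn] B /=.
  by rewrite /dirac/= !indicE; congr ((nat_of_bool _)%:R%:E);
    apply/idP/idP => /set_mem/= h; exact/mem_set.
rewrite ge0_integral_pushforward//; last first.
  by move=> i _; apply: iter_int_ge0 => s _; rewrite lee_fin.
rewrite /distribution/= /pushforward/= /product_measure1/=.
apply: eq_integral => z _ /=.
rewrite -IHn.
congr (iid P n _); apply/seteqP; split=> S /=; rewrite /xsection/=.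
  by move/set_mem.
by move=> BS; apply/mem_set.
Qed.

(** The event is defined by avoiding a bad set of codes, hence is measurable whatever the oracle
    does. *)
Lemma iid_avoid n (B : set (seq nat)) (delta : R) :
  (iter_int (distribution P phi) n (fun s => (\1_B s)%:E) <= delta%:E)%E ->
  exists E : set (n.-tuple T), [/\ measurable E,
    ((1 - delta)%:E <= iid P n E)%E & forall S, E S -> ~ B (map phi S)].
Proof.
move=> Bd; exists (~` [set S : n.-tuple T | B (map phi S)]).
have mB := @measurable_map_tuple n B.
split=> //; first exact: measurableC.
rewrite probability_setC//.
by rewrite EFinB leeB// iid_map.
Qed.

End iid_map.

(** * Adversarial losses as indicators *)

Section boolean_loss.
Context (d : measure_display) (R : realType) (X : metricMeasurableType d R).
Implicit Types (U V : X -> set X) (h g : X -> bool) (z : X * bool).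

Definition mis U h z : bool := `[< exists2 x, U z.1 x & h x != z.2 >].

Lemma adv_lossE U h x y : adv_loss U h x y = (mis U h (x, y))%:R :> R.
Proof.
rewrite /adv_loss; set E := [set _ | _ in _].
case: (boolP (mis U h (x, y))) => [/asboolP[/= t Ut ht]|/asboolPn nm].
  apply/eqP; rewrite eq_le; apply/andP; split.
    apply: ge_sup; first by exists (h t != y)%:R, t.
    by move=> _ [u _ <-]; rewrite ler_nat leq_b1.
  apply: ub_le_sup; last by exists t => //; rewrite ht.
  by exists 1 => _ [u _ <-]; rewrite lern1 leq_b1.
have E0 : E `<=` [set 0].
  move=> _ [u Uu <-] /=; case: eqVneq => //= hu.
  by case: nm; exists u.
(* An empty perturbation set gives [sup set0 = 0], the loss of a point without error. *)
have [->|E1] := subset_set1 E0; first by rewrite sup0.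
by rewrite E1 sup1.
Qed.

Lemma loss_setE U h : loss_set U h = [set z | mis U h z].
Proof.
apply/seteqP; split=> -[x y]; rewrite /loss_set /= adv_lossE.
  by case: (mis U h _) => // /eqP; rewrite eq_sym oner_eq0.
by move=> ->.
Qed.

Lemma emp_riskE U h (S : seq (X * bool)) :
  emp_risk U S h = (count (mis U h) S)%:R / (size S)%:R.
Proof.
rewrite /emp_risk -sum1_count natr_sum; congr (_ / _).
rewrite [RHS]big_mkcond /=; apply: eq_bigr => -[x y] _.
by rewrite adv_lossE; case: (mis U h _).
Qed.

Lemma adv_riskE U (P : probability (X * bool)%type R) h :
  measurable (loss_set U h) -> adv_risk U P h = P [set z | mis U h z].
Proof.
rewrite loss_setE => mU; transitivity (P ([set z | mis U h z] `&` setT)).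
  rewrite -integral_indic//; apply: eq_integral => -[x y] _.
  rewrite adv_lossE indicE; congr (_%:R%:E); congr nat_of_bool.
  by apply/idP/idP => [m|/set_mem//]; exact/mem_set.
by rewrite setIT.
Qed.

Lemma le_adv_risk U V (P : probability (X * bool)%type R) h g :
  measurable (loss_set U h) -> measurable (loss_set V g) ->
  (forall z, mis U h z -> mis V g z) -> (adv_risk U P h <= adv_risk V P g)%E.
Proof.
move=> mU mV UV; rewrite !adv_riskE//.
rewrite !loss_setE in mU mV.
by apply: le_measure UV; exact: mem_set.
Qed.

End boolean_loss.

(** * The discretized learner *)

Section discretization.
Context (d : measure_display) (R : realType) (X : metricMeasurableType d R).
Context (H : set (X -> bool)) (vc k : nat) (r gamma : R) (C : set X).
Context (oracle A : seq (X * bool) -> X -> bool).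
Local Notation V := (ball_perturbation (r * (1 + gamma)) : X -> set X).
Local Notation U := (ball_perturbation r : X -> set X).
Local Notation CC := (fun x => V x `&` C).
Context (vcH : is_VCdim H vc).
Context (cC : countable C).
Context (covC : is_cover C (r * gamma)).
Context (kC : forall x, CC x #<= `I_k).
Context (ermH : is_RERM CC H oracle).
Context (nnA : RERM_and_Discretize C oracle A).
Context (mV : forall h, H h -> measurable (loss_set V h)).
Context (mC : forall h, H h -> measurable (loss_set CC h)).
Context (mU : forall S, measurable (loss_set U (A S))).
Implicit Types (P : probability (X * bool)%type R) (S : seq (X * bool)).

Let oracleH S : H (oracle S).
Proof. by have [] := ermH S. Qed.

Lemma mis_discretized S z : mis U (A S) z -> mis CC (oracle S) z.
Proof.
move=> /asboolP[x Ux Ax]; have [c [Cc nc] Ac] := nnA S x.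
apply/asboolP; exists c; last by rewrite -Ac.
(* [c] is at least as close to [x] as the point [c'] of the cover, and the triangle inequality
   through [x] gives [r + r * gamma]. *)
split=> //=; have [c' Cc' xc'] := covC x.
apply: (le_trans (metric_triangle _ x _)); rewrite mulrDr mulr1.
by apply: lerD => //; apply: le_trans (nc _ Cc') xc'.
Qed.

Lemma adv_risk_discretized P S :
  (adv_risk U P (A S) <= adv_risk CC P (oracle S))%E.
Proof. by apply: le_adv_risk => //; [exact: mC|exact: mis_discretized]. Qed.

Lemma adv_risk_tolerant P h : H h -> (adv_risk CC P h <= adv_risk V P h)%E.
Proof.
move=> Hh; apply: le_adv_risk; [exact: mC|exact: mV|].
move=> z /asboolP[x [Vx _] hx]; apply/asboolP; by exists x.
Qed.

(** The loss at [(x, y)] depends only on [y] and the finite set [CC x], and a countable set has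
    countably many finite subsets. *)
Lemma exists_code : exists code : X * bool -> nat,
  forall z z', code z = code z' -> forall f, [set mis CC h | h in H] f -> f z = f z'.
Proof.
have /countable_injP[iota iota_inj] := countable_finite_subset cC.
exists (fun z => choice.pickle (iota (CC z.1), z.2)).
move=> [x y] [x' y'] /(pcan_inj choice.pickleK)[E <-] _ [h _ <-].
have CCin t : CC t \in [set B | B `<=` C /\ finite_set B].
  apply/mem_set; split; first by move=> ? [].
  exact: card_le_finite (kC t) (finite_II k).
have CCE : V x `&` C = V x' `&` C := iota_inj _ _ (CCin x) (CCin x') E.
have CCx t : (V x `&` C) t <-> (V x' `&` C) t by rewrite CCE.
by apply/asboolP/asboolP => -[t /CCx Ct ht]; exists t.
Qed.

(** A sample and its ghost only involve the values of [h] on at most [2 * n * k] points;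
    [VCdim_cover] doubles this number and adds 1. *)
Lemma cover_size_mis (rep : nat -> X * bool) n :
  cover_size [set mis CC h \o rep | h in H] n (((4 * n * k).+1 ^ vc)%:R : R).
Proof.
move=> s sn.
have fin x : finite_set (CC x) by exact: card_le_finite (kC x) (finite_II k).
pose D := flatten [seq (fset_set (CC (rep i).1) : seq X) | i <- s].
have sD : (size D <= 2 * n * k)%N.
  rewrite size_flatten; apply: (@leq_trans (size s * k)); last first.
    by rewrite sn addnn mul2n.
  rewrite /D; elim: (s) => [//|i u IHu] /=.
  rewrite mulSn leq_add//; exact: geq_card_fset_set (kC _).
have [L sL [LH HL]] := VCdim_cover D vcH.
exists (map (fun h => mis CC h \o rep) L).
  rewrite size_map ler_nat (leq_trans sL)// leq_expl// ltnS.
  by move: sD; rewrite -!mulnA -muln2; move: (size D) (n * k)%N => a b; lia.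
move=> _ [h Hh <-]; have [l lL hl] := HL h Hh.
exists (mis CC l \o rep).
  by elim: (L) lL => //= g L' IHL' [->|/IHL' ?]; [left|right].
move=> i is_ /=.
have hl' x : CC (rep i).1 x -> h x = l x.
  move=> Cx; apply: hl; apply/flatten_mapP; exists i => //=.
  by rewrite in_fset_set//; exact/mem_set.
by apply/asboolP/asboolP => -[x Cx hx]; exists x; rewrite // ?hl'// -hl'.
Qed.

(** Two hypotheses that differ at a point would shatter it, so in dimension 0 the oracle returns the
    only member of [H], whatever the sample. *)
Lemma discretized_learns_dim0 P S (eps : R) : vc = 0%N -> 0 <= eps ->
  (adv_risk U P (A S) <= opt_risk V P H + eps%:E)%E.
Proof.
move=> vc0 eps0; apply: (le_trans (adv_risk_discretized P S)).
apply: (@le_trans _ _ (opt_risk V P H)); last by rewrite leeDl// lee_fin.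
apply/ereal_infP => _ [h Hh <-].
suff -> : oracle S = h by exact: adv_risk_tolerant.
apply/funext => x; apply/eqP; apply: contraT => hx.
have [_ /(_ 1%N [set x])] := vcH; rewrite vc0 ltnn; apply.
  exact: card_set1.
move=> B /subset_set1[->|->].
- have [|] := boolP (h x) => hx'; last first.
    by exists h => //; apply/seteqP; split=> // y [/= -> hy]; rewrite hy in hx'.
  exists (oracle S) => //; apply/seteqP; split=> // y [/= -> hy].
  by rewrite hy hx' in hx.
- have [|] := boolP (h x) => hx'.
    by exists h => //; apply/seteqP; split=> [y []//|y ->].
  exists (oracle S) => //; apply/seteqP; split=> [y []//|y -> /=]; split=> //.
  by move: hx hx'; case: (oracle S x); case: (h x).
Qed.

Let H_neq0 : exists h, H h. Proof. by exists (oracle [::]). Qed.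

Section through_nat.
Context (P : probability (X * bool)%type R).
Context (phi : {mfun (X * bool)%type >-> nat}) (rep : nat -> X * bool).
Context (repP : forall h, H h -> forall z, mis CC h (rep (phi z)) = mis CC h z).
Local Notation Q := (distribution P phi).
Local Notation FN := [set mis CC h \o rep | h in H].
Local Notation risk h := (fine (Q [set i | (mis CC h \o rep) i])).

Let FN_neq0 : exists f, FN f.
Proof. by have [h Hh] := H_neq0; exists (mis CC h \o rep), h. Qed.

Let adv_riskN h : H h -> adv_risk CC P h = (risk h)%:E.
Proof.
move=> Hh; rewrite adv_riskE; last exact: mC.
rewrite fineK ?fin_num_measure// /distribution/= /pushforward/=.
by congr (P _); apply/seteqP; split=> z /=; rewrite repP.
Qed.

Let countN h (S : seq (X * bool)) : H h ->
  count (mis CC h \o rep) (map phi S) = count (mis CC h) S.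
Proof. by move=> Hh; rewrite count_map; apply: eq_count => z /=; rewrite repP. Qed.

Let erm_count h (S : seq (X * bool)) : H h ->
  (count (mis CC (oracle S) \o rep) (map phi S) <=
   count (mis CC h \o rep) (map phi S))%N.
Proof.
move=> Hh; rewrite !countN//; have [_ /(_ h Hh)] := ermH S.
(* For the empty sample both counts are 0; otherwise the denominators cancel. *)
rewrite !emp_riskE; case: (S) => [//|z u].
by rewrite ler_pM2r ?invr_gt0 ?ltr0n// ler_nat.
Qed.

(** Outside [B0] some hypothesis makes no error on the sample, hence neither does the oracle's;
    outside [B1] that one has risk at most [eps]. [B0] is null as the optimal risk is 0. *)
Lemma realizable_event (n : nat) (eps delta : R) :
  0 < eps < 1 -> 0 < delta < 1 -> tolerantly_realizable V H P ->
  (0 < vc)%N -> (sample_bound vc k eps delta <= n)%N ->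
  exists E : set (n.-tuple (X * bool)),
    [/\ measurable E, ((1 - delta)%:E <= iid P n E)%E &
        forall S : n.-tuple (X * bool), E S ->
          (adv_risk U P (A S) <= opt_risk V P H + eps%:E)%E].
Proof.
move=> e01 d01 PV vc0 Nn; have /andP[e0 e1] := e01.
pose B1 := [set s | exists f, [/\ FN f, count f s = 0%N &
  eps < fine (Q [set i | f i])]].
pose B0 := [set s | forall f, FN f -> (0 < count f s)%N].
have [E [mE PE EB]] : exists E : set (n.-tuple (X * bool)), [/\ measurable E,
    ((1 - delta)%:E <= iid P n E)%E &
    forall S : n.-tuple (X * bool), E S -> ~ (B1 `|` B0) (map phi S)].
  apply: iid_avoid; apply: (le_trans (iter_int_setU _ _ _ _)).
  rewrite [X in (_ + X)%E]consistent_ae ?adde0; last first.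
    move=> e e_gt0; have : (opt_risk V P H < e%:E)%E by rewrite PV lte_fin.
    move=> /ereal_inf_lt[_ [h Hh <-] he]; exists (mis CC h \o rep).
      by exists h.
    by rewrite -lte_fin -adv_riskN//; apply: le_lt_trans he; exact: adv_risk_tolerant.
  apply: le_trans (realizable_deviation _ (@cover_size_mis rep n) FN_neq0 e01) _.
  rewrite lee_fin; apply: le_trans (sample_bound_suff e01 d01 vc0 Nn).
  rewrite -[leRHS]mulrA; set G := _%:R; set x := expR _; set y := expR _.
  have xy : x <= y.
    by rewrite ler_expR lerN2 ler_wpM2l ?mulr_ge0 ?(ltW e0)//; lra.
  have y0 : 0 <= y by exact: expR_ge0.
  have Gx : G * x <= G * y by rewrite ler_wpM2l.
  have : 0 <= G * y by rewrite mulr_ge0.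
  lra.
exists E; split=> // S /EB nB.
rewrite PV add0e; apply: (le_trans (adv_risk_discretized P S)).
rewrite adv_riskN// lee_fin leNgt; apply/negP => bad.
apply: nB; have [c0|c0] := posnP (count (mis CC (oracle S) \o rep) (map phi S)).
  by left; exists (mis CC (oracle S) \o rep); split=> //; exists (oracle S).
by right=> _ [h Hh <-]; exact: leq_trans c0 (erm_count S Hh).
Qed.

(** Three errors of [eps / 3] add up: the choice of a nearly optimal [h], the uniform
    underestimation outside [B1], and the overestimation of [h] outside [B2]. Only this fixed [h]
    has to be controlled from above. *)
Lemma agnostic_event (n : nat) (eps delta : R) :
  0 < eps < 1 -> 0 < delta < 1 ->
  (0 < vc)%N -> (sample_bound vc k (eps ^+ 2) delta <= n)%N ->
  exists E : set (n.-tuple (X * bool)),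
    [/\ measurable E, ((1 - delta)%:E <= iid P n E)%E &
        forall S : n.-tuple (X * bool), E S ->
          (adv_risk U P (A S) <= opt_risk V P H + eps%:E)%E].
Proof.
move=> e01 d01 vc0 Nn; have /andP[e0 e1] := e01.
have n0 : (0 < n)%N.
  by apply: leq_trans Nn; rewrite /sample_bound; case: (vc) vc0.
have e3 : 0 < eps / 3 < 1 by apply/andP; split; lra.
have [v vE] : exists v : R, opt_risk V P H = v%:E.
  have [h Hh] := H_neq0; exists (fine (opt_risk V P H)); rewrite fineK//.
  rewrite ge0_fin_numE; last first.
    apply/ereal_infP => _ [g Hg <-]; rewrite adv_riskE//; exact: mV.
  apply: (@le_lt_trans _ _ (adv_risk V P h)).
    by apply: ereal_inf_lbound; exists h.
  rewrite adv_riskE; last exact: mV.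
  apply: (@le_lt_trans _ _ 1%E); last exact: ltry.
  by apply: probability_le1; rewrite -loss_setE; exact: mV.
have [h Hh ho] : exists2 h, H h & risk h < v + eps / 3.
  have : (opt_risk V P H < (v + eps / 3)%:E)%E by rewrite vE lte_fin; lra.
  move=> /ereal_inf_lt[_ [h Hh <-] he]; exists h => //.
  by rewrite -lte_fin -adv_riskN//; apply: le_lt_trans he; exact: adv_risk_tolerant.
pose B1 := [set s | exists2 f, FN f &
  (count f s)%:R + n%:R * (eps / 3) < n%:R * fine (Q [set i | f i])].
pose B2 := [set s | size s = n /\
  n%:R * risk h + n%:R * (eps / 3) < (count (mis CC h \o rep) s)%:R].
have [E [mE PE EB]] : exists E : set (n.-tuple (X * bool)), [/\ measurable E,
    ((1 - delta)%:E <= iid P n E)%E &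
    forall S : n.-tuple (X * bool), E S -> ~ (B1 `|` B2) (map phi S)].
  apply: iid_avoid; apply: (le_trans (iter_int_setU _ _ _ _)).
  apply: le_trans (leeD (agnostic_deviation _ (@cover_size_mis rep n) FN_neq0 e3)
    (upper_deviation _ _ _ e3)) _.
  have e201 : 0 < eps ^+ 2 < 1 by rewrite exprn_gt0// expr_lt1// ltW.
  rewrite lee_fin; apply: le_trans (sample_bound_suff e201 d01 vc0 Nn).
  have -> : n%:R * (eps / 3) ^+ 2 / 8 = n%:R * eps ^+ 2 / 72 by field.
  rewrite -[leRHS]mulrA; set G := _%:R; set y := expR _.
  have y0 : 0 <= y by exact: expR_ge0.
  (* As [G >= 1], the single-hypothesis bound fits under the second copy of the uniform one. *)
  have Gx : 1 * y <= G * y by rewrite ler_wpM2r// ler1n expn_gt0.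
  lra.
exists E; split=> // S /EB nB.
apply: (le_trans (adv_risk_discretized P S)).
rewrite adv_riskN// vE -EFinD lee_fin leNgt; apply/negP => bad.
have sS : size (map phi S) = n by rewrite size_map size_tuple.
have h1 : n%:R * risk (oracle S) <=
    (count (mis CC (oracle S) \o rep) (map phi S))%:R + n%:R * (eps / 3).
  rewrite leNgt; apply/negP => lt1; apply: nB; left.
  by exists (mis CC (oracle S) \o rep) => //; exists (oracle S).
have h2 : (count (mis CC h \o rep) (map phi S))%:R <=
    n%:R * risk h + n%:R * (eps / 3).
  by rewrite leNgt; apply/negP => lt1; apply: nB; right.
have h3 : (count (mis CC (oracle S) \o rep) (map phi S))%:R <=
    (count (mis CC h \o rep) (map phi S))%:R :> R.
  by rewrite ler_nat; exact: erm_count.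
have np : 0 < n%:R :> R by rewrite ltr0n.
have : n%:R * (v + eps) < n%:R * risk (oracle S) by rewrite ltr_pM2l.
have : n%:R * risk h < n%:R * (v + eps / 3) by rewrite ltr_pM2l.
have -> : n%:R * (v + eps) = n%:R * (v + eps / 3) + n%:R * (eps / 3) + n%:R * (eps / 3).
  by field.
lra.
Qed.

End through_nat.

Let factor : exists (phi : {mfun (X * bool)%type >-> nat}) (rep : nat -> X * bool),
  forall h, H h -> forall z, mis CC h (rep (phi z)) = mis CC h z.
Proof.
have [code codeP] := exists_code.
have [|phi [rep repP]] := discrete_factor _ codeP.
  by move=> _ [h Hh <-]; rewrite -loss_setE; exact: mC.
by exists phi, rep => h Hh z; apply: repP; exists h.
Qed.

Lemma realizable_learns : tolerantly_PAC_learns U V H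
  (tolerantly_realizable V H) A (sample_bound vc k).
Proof.
move=> P PV eps delta e01 d01 n Nn; have [vc0|vc0] := posnP vc.
  exists setT; split=> //.
    rewrite probability_setT lee_fin gerBl.
    by have /andP[/ltW] := d01.
  by move=> S _; apply: discretized_learns_dim0 => //; have /andP[/ltW] := e01.
have [phi [rep repP]] := factor.
exact: (realizable_event repP).
Qed.

Lemma agnostic_learns : tolerantly_PAC_learns U V H
  (@agnostic d R X) A (fun eps => sample_bound vc k (eps ^+ 2)).
Proof.
move=> P _ eps delta e01 d01 n Nn; have [vc0|vc0] := posnP vc.
  exists setT; split=> //.
    rewrite probability_setT lee_fin gerBl.
    by have /andP[/ltW] := d01.
  by move=> S _; apply: discretized_learns_dim0 => //; have /andP[/ltW] := e01.
have [phi [rep repP]] := factor.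
exact: (agnostic_event P repP e01 d01 vc0 Nn).
Qed.

End discretization.

Theorem theorem12 (R : realType) :
  exists m n : nat -> nat -> R -> R -> nat,
  [/\ softO (@parameters R) (sample_size m) (@realizable_rate R),
      softO (@parameters R) (sample_size n) (@agnostic_rate R) &
      forall (d : measure_display) (X : metricMeasurableType d R)
        (H : set (X -> bool)) (vc k : nat) (r gamma : R) (C : set X)
        (oracle : seq (X * bool) -> X -> bool)
        (A : seq (X * bool) -> X -> bool),
      let V : X -> set X := ball_perturbation (r * (1 + gamma)) in
      let U : X -> set X := ball_perturbation r in
      let CC : X -> set X := fun x => V x `&` C in
      is_VCdim H vc ->
      0 < r -> 0 < gamma ->
      countable C ->
      is_cover C (r * gamma) ->
      (forall x, CC x #<= `I_k) ->
      is_RERM CC H oracle ->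
      RERM_and_Discretize C oracle A ->
      (forall h, H h -> measurable (loss_set V h)) ->
      (forall h, H h -> measurable (loss_set CC h)) ->
      (forall S, measurable (loss_set U (A S))) ->
      tolerantly_PAC_learns U V H (tolerantly_realizable V H) A (m vc k) /\
      tolerantly_PAC_learns U V H (@agnostic d R X) A (n vc k)].
Proof.
(* Logarithmic power 1 suffices for [softO], and the agnostic size is the realizable one at
   [eps ^+ 2]. *)
exists (@sample_bound R), (fun vc k eps => sample_bound vc k (eps ^+ 2)); split.
- exists (2 ^+ 14), 1%N => -[[[vc k] eps] delta] [e01 d01].
  exact: sample_bound_le.
- exists (2 ^+ 14), 1%N => -[[[vc k] eps] delta] [e01 d01].
  have e201 : 0 < eps ^+ 2 < 1.
    by have /andP[e0 e1] := e01; rewrite exprn_gt0// expr_lt1// ltW.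
  exact: sample_bound_le.
move=> d X H vc k r gamma C oracle A V U CC vcH _ _ cC covC kC erm nnA mV mC mU.
split.
  exact: (realizable_learns vcH cC covC kC erm nnA mV mC mU).
exact: (agnostic_learns vcH cC covC kC erm nnA mV mC mU).
Qed.
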